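(* For every integer $n>2$, the expected fraction of leaves in a random recursive tree of size $n$ is $$r_0(n)=\ell_0(n)=\frac12+\frac1{n(n-1)}.$$ The expected fractions of nodes of rank $1$ and at layer $1$ are, respectively, $$r_1(n)=\sum_{j=0}^{n-2}\frac{(-1)^j}{j!}+\frac1{n(n-1)}\sum_{j=0}^{n-3}\frac{(-1)^j}{j!}(j+2),$$ $$\ell_1(n)=-\frac12+\frac1n-\frac1{n-1}+\frac2{n!}+\sum_{v=2}^{n-1}\frac1{v!}-\frac1{n(n-1)}\sum_{v=0}^{n-3}\frac1{v!}+\frac2{n!}\sum_{j=1}^{n-2}\sum_{v=0}^{j-1}\frac{j!}{v!},$$ and, as $n\to\infty$, $$r_1(n)=e^{-1}+\frac{e^{-1}}{n(n-1)}+O\left(\frac1{(n+1)!}\right),\qquad \ell_1(n)=e-\frac52+\frac{e-1}{n^2}+O\left(\frac1{n^3}\right).$$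
   Context: A random recursive tree (RRT) $G_n$ of size $n$ is a random labeled tree on the node set $\{1,\dots,n\}$ built as follows: start with node $1$; for $t=2,\dots,n$, node $t$ is attached by an edge to one node chosen uniformly at random from the existing nodes $\{1,\dots,t-1\}$, independently of previous choices. A leaf is a node of degree $1$ (the root, node $1$, is also a leaf if it has degree $1$). The rank of a node is its graph distance to the closest leaf, so leaves have rank $0$. The layer of a node is the number of times all current leaves must be simultaneously stripped off (removed) from the tree for the node to become a leaf; leaves of the original tree are at layer $0$, and if after some number of rounds the remaining tree consists of a single isolated node, that node counts as a leaf at that stage (so, e.g., the center of a star with at least 3 nodes is at layer $1$). Let $R_{n,k}$ and $L_{n,k}$ be the numbers of nodes of rank $k$ and at layer $k$ in $G_n$, and let $r_k(n)=\mathbb E[R_{n,k}/n]$ and $\ell_k(n)=\mathbb E[L_{n,k}/n]$ be the expected fractions. *)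

(* Defs.v *)
From HB Require Import structures.
From mathcomp Require Import all_boot all_order all_algebra.
From mathcomp Require Import all_classical all_reals all_analysis.

Set Implicit Arguments.
Unset Strict Implicit.
Unset Printing Implicit Defensive.

Import Order.TTheory GRing.Theory Num.Theory.
Import numFieldNormedType.Exports.

Local Open Scope ring_scope.

Section GraphNotions.
Variables (T : finType) (e : rel T).

Definition degree (v : T) : nat := #|[set u | e v u]|.

Definition leaf (v : T) : bool := degree v == 1%N.

Definition walk (k : nat) (u v : T) : bool :=
  [exists p : k.-tuple T, path e u p && (last u p == v)].

(* The least length of a walk from u to v; in a connected graph it is smaller
   than #|T|, and the value #|T| stands for infinity. *)
Definition gdist (u v : T) : nat := find (fun k => walk k u v) (iota 0 #|T|).

(* The value #|T| stands for infinity (no leaf is reachable from v). *)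
Definition rank (v : T) : nat := \big[minn/#|T|]_(u | leaf u) gdist v u.

(* Leaves of the subgraph induced on S, where an isolated node counts as a leaf
   if it is the only node left. *)
Definition leaves_of (S : {set T}) : {set T} :=
  [set v in S | (#|[set u in S | e v u]| == 1%N) || (S == [set v])].

Definition strip (S : {set T}) : {set T} := S :\: leaves_of S.

(* Every stripping of a nonempty tree removes a node, so fewer than #|T|
   strippings suffice for any node to become a leaf. *)
Definition layer (v : T) : nat :=
  find (fun k => v \in leaves_of (iter k strip [set: T])) (iota 0 #|T|).

End GraphNotions.

(* Attachment histories.  Nodes are indexed from 0, so that the index i : 'I_n
   is the node labeled i + 1.  The index t.+1, for t < n - 1, is attached to the
   index f t, which ranges over {0, ..., t}. *)
Definition history (n : nat) : finType :=
  {dffun forall t : 'I_n.-1, 'I_t.+1}.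

Definition rrt_edge (n : nat) (f : history n) : rel 'I_n :=
  fun x y => [exists t : 'I_n.-1,
    ((x == t.+1 :> nat) && (y == f t :> nat)) ||
    ((y == t.+1 :> nat) && (x == f t :> nat))].

Definition nb_rank (n k : nat) (f : history n) : nat :=
  #|[set v : 'I_n | rank (rrt_edge f) v == k]|.

Definition nb_layer (n k : nat) (f : history n) : nat :=
  #|[set v : 'I_n | layer (rrt_edge f) v == k]|.

Section Law.
Variable R : realType.

(* The choices f t are independent, and f t is uniform over t.+1 values. *)
Definition rrt_prob (n : nat) (f : history n) : R :=
  \prod_(t < n.-1) (t.+1%:R)^-1.

Definition rrt_expect (n : nat) (X : history n -> R) : R :=
  \sum_(f : history n) rrt_prob f * X f.

Definition r_ (k n : nat) : R :=
  rrt_expect (fun f : history n => (nb_rank k f)%:R / n%:R).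

Definition l_ (k n : nat) : R :=
  rrt_expect (fun f : history n => (nb_layer k f)%:R / n%:R).

End Law.

(* Main.v *)
Require Import Defs.
From HB Require Import structures.
From mathcomp Require Import all_boot all_order all_algebra.
From mathcomp Require Import all_classical all_reals all_analysis.
From mathcomp Require Import zify ring lra.
Import Order.TTheory GRing.Theory Num.Theory.
Import numFieldNormedType.Exports.
Local Open Scope ring_scope.

(** Root the tree at its first node.  The state of a node is the pair (l, i),
where l counts its childless children and i its other children.  Every neighbour
of a node other than its parent is a child, so the state of a node decides
whether its rank or its layer is zero or one, with a single exception: the
parent of a node is a leaf when it is the root and the root has one child only.
That child is called the stem.  Hence the numbers of nodes of rank one and at
layer one are sums over the nodes of functions of the state, corrected by one
term for the root and one for the stem ([nb_rank1E], [nb_layer1E]).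

Attaching a new node to one of m nodes, chosen uniformly, moves the state (l, i)
of a given node to (l + 1, i) if that node is chosen, to (l - 1, i + 1) if one
of its l childless children is chosen, and leaves it alone otherwise; the new
node starts in the state (0, 0).  The mean of any function of the state
therefore obeys a linear recurrence in the number of nodes, governed by the
operator [drift] ([censusS]).  This operator is triangular on three families:
the binomials 'C(l, k), the indicators of the states (j, 0) and those of the
states (j, 1).  So the recurrences are solved by induction once the solution is
guessed.  At the root the guess comes from permutations: the children of the
root have subtrees whose sizes are distributed as the cycle lengths of a uniform
permutation of the other nodes, so that l is the number of fixed points and i
the number of longer cycles ([root_binl], [root_star_at], [root_near_star_at]).
Summed over the other nodes the solutions are proportional to the number of
nodes, up to a boundary term ([rest_binl], [rest_star_at]).  The stem needs no
separate count: given that the root has one child, the tree above that child is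
again a random recursive tree, with one node less ([stem_meanE]).

The probability of having no childless child is the alternating sum of the
binomial moments, which produces the partial sums of exp(-1) in the rank
formula.  For layers, the stars carried by nodes other than the root produce the
partial sums of exp(1), while root and stem bring in the probability that a root
has exactly one child with descendants ([mean_one_inner_kid]), whose recurrence
unrolls to the double sum ([fact_mean_one_inner_kid]).

The expansions follow from these forms by bounding the tails of the exponential
series ([expR_tail]) and from [mean_one_inner_kid] being O(1/n). *)

Set Implicit Arguments.
Unset Strict Implicit.
Unset Printing Implicit Defensive.

(** * Ranks and layers zero and one in a finite graph *)

Lemma card_ord_pred (n : nat) (P : pred 'I_n) :
  #|[set u | P u]| = (\sum_(u < n) P u)%N.
Proof.
by rewrite -sum1dep_card big_mkcond; apply: eq_bigr => u _; case: (P u).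
Qed.

Section GraphFacts.
Variables (T : finType) (e : rel T).

Lemma walk0 (u v : T) : walk e 0 u v = (u == v).
Proof.
apply/existsP/idP => [[p]|/eqP ->]; first by rewrite (tuple0 p) /=.
by exists [tuple] => /=.
Qed.

Lemma walk1 (u v : T) : walk e 1 u v = e u v.
Proof.
apply/existsP/idP => [[p]|euv].
  by case/tupleP: p => x p; rewrite (tuple0 p) /= andbT => /andP[exu /eqP <-].
by exists [tuple v]; rewrite /= euv eqxx.
Qed.

Lemma gdist_le0 (u v : T) : (gdist e u v <= 0)%N = (u == v).
Proof.
have : (0 < #|T|)%N by apply/card_gt0P; exists u.
rewrite /gdist; case: #|T| => // k _ /=.
by rewrite walk0; case: ifP.
Qed.

Lemma gdist_le1 (u v : T) :
  (1 < #|T|)%N -> (gdist e u v <= 1)%N = (u == v) || e u v.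
Proof.
rewrite /gdist; case: #|T| => [|[|k]] // _ /=.
by rewrite walk0 walk1; case: (u == v); case: (e u v).
Qed.

(** The default value of the minimum fails the test because k < #|T|. *)
Lemma rank_le (k : nat) (v : T) : (k < #|T|)%N ->
  (rank e v <= k)%N = [exists u, leaf e u && (gdist e v u <= k)%N].
Proof.
move=> kT; rewrite /rank -big_filter.
have -> : [exists u, leaf e u && (gdist e v u <= k)%N] =
   has (fun u => gdist e v u <= k)%N [seq u <- index_enum T | leaf e u].
  apply/existsP/hasP => [[u /andP[lu du]]|[u]].
    by exists u => //; rewrite mem_filter lu mem_index_enum.
  by rewrite mem_filter => /andP[lu _] du; exists u; rewrite lu.
elim: [seq _ <- _ | _] => [|u s IHs] /=.
  by rewrite big_nil leqNgt kT.
by rewrite big_cons geq_min IHs.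
Qed.

Lemma rank_eq0 (v : T) : (rank e v == 0)%N = leaf e v.
Proof.
rewrite -leqn0 rank_le; last by apply/card_gt0P; exists v.
apply/existsP/idP => [[u]|lv]; last by exists v; rewrite lv gdist_le0 eqxx.
by rewrite gdist_le0 => /andP[lu /eqP ->].
Qed.

Lemma rank_eq1 (v : T) : (1 < #|T|)%N ->
  (rank e v == 1)%N = ~~ leaf e v && [exists u, leaf e u && e v u].
Proof.
move=> T1; rewrite -rank_eq0.
have -> : (rank e v == 1)%N = (rank e v != 0)%N && (rank e v <= 1)%N.
  by case: (rank e v) => [|[]].
rewrite rank_le //; apply: andb_id2l; rewrite rank_eq0 => nlv.
apply: eq_existsb => u; rewrite gdist_le1 //.
by apply: andb_id2l => lu; case: eqP => // vu; rewrite vu lu in nlv.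
Qed.

Lemma leaves_of_setT (v : T) : (1 < #|T|)%N ->
  (v \in leaves_of e [set: T]) = leaf e v.
Proof.
move=> T1; rewrite !inE /= /leaf /degree.
have -> : ([set: T] == [set v]) = false.
  by apply/negP => /eqP E; move: T1; rewrite -cardsT E cards1.
by rewrite orbF; congr (_ == _); apply: eq_card => u; rewrite !inE.
Qed.

Lemma layer_eq0 (v : T) : (1 < #|T|)%N -> (layer e v == 0)%N = leaf e v.
Proof.
move=> T1; rewrite -leaves_of_setT // /layer.
case: #|T| T1 => [|k] //= _; by case: ifP.
Qed.

(** One stripping leaves exactly the non-leaves, so a node becomes a leaf at
    that moment either by keeping a single non-leaf neighbour or by being the
    last node. *)
Lemma layer_eq1 (v : T) : (1 < #|T|)%N ->
  (layer e v == 1)%N = ~~ leaf e v &&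
    ((#|[set u | e v u && ~~ leaf e u]| == 1)%N ||
     [forall u, (u != v) ==> leaf e u]).
Proof.
move=> T1; have lT (u : T) := leaves_of_setT u T1.
rewrite /layer -lT.
have -> : (find (fun k => v \in leaves_of e (iter k (strip e) [set: T]))
             (iota 0 #|T|) == 1)%N
   = (v \notin leaves_of e [set: T]) && (v \in leaves_of e (strip e [set: T])).
  case: #|T| T1 => [|[|k]] //= _.
  by case: (v \in _) => //=; case: ifP.
have inS (u : T) : (u \in strip e [set: T]) = ~~ leaf e u.
  by rewrite finset.in_setD lT finset.in_setT andbT.
apply: andb_id2l; rewrite lT => nlv.
rewrite [in LHS]finset.in_set inS nlv /=.
congr orb.
  congr (_ == _); apply: eq_card => u.
  by rewrite finset.in_set inS [RHS]finset.in_set andbC.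
apply/eqP/forallP => [E u|E].
  apply/implyP => uv; apply/negPn/negP => nlu.
  by move: nlu; rewrite -inS E finset.in_set1 (negbTE uv).
apply/setP => u; rewrite inS finset.in_set1.
by have := E u; case: (eqVneq u v) => [-> _ | _ /= ->].
Qed.

End GraphFacts.

(** * Recursive trees through their parent function *)

(** Parents as plain numbers, free of the dependent codomains 'I_t.+1 of a
    history; the root and the numbers beyond n get the default value 0. *)
Definition par (n : nat) (f : history n.+1) (x : nat) : nat :=
  if insub x.-1 : option 'I_n is Some t then (f t : nat) else 0%N.

Lemma par_lt (n : nat) (f : history n.+1) (x : nat) :
  (0 < x)%N -> (par f x < x)%N.
Proof.
case: x => // x _; rewrite /par; case: insubP => //= t _ <-.
exact: ltn_ord.
Qed.

Lemma rrt_edgeE (n : nat) (f : history n.+1) (x y : 'I_n.+1) :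
  rrt_edge f x y = ((0 < x)%N && (y == par f x :> nat))
                || ((0 < y)%N && (x == par f y :> nat)).
Proof.
have half (a b : 'I_n.+1) :
    [exists t : 'I_n, (a == t.+1 :> nat) && (b == f t :> nat)]
    = (0 < a)%N && (b == par f a :> nat).
  apply/existsP/andP => [[t /andP[/eqP -> /eqP ->]]|[a0 /eqP ->]].
    split=> //; rewrite /par /=.
    case: insubP => [s _ ts|]; last by rewrite ltn_ord.
    by have -> : s = t by apply: val_inj.
  have an : (a.-1 < n)%N by have := ltn_ord a; lia.
  exists (Ordinal an); apply/andP; split; first by rewrite /= prednK.
  rewrite /par; case: insubP => [s _ sa|]; last by rewrite an.
  by have -> : s = Ordinal an by apply: val_inj.
rewrite -!half; apply/existsP/orP => [[t /orP[E|E]]|[] /existsP[t E]].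
- by left; apply/existsP; exists t.
- by right; apply/existsP; exists t.
- by exists t; rewrite E.
- by exists t; rewrite E orbT.
Qed.

Section Shape.
Variables (n : nat) (f : history n.+1).

(** The guard excludes the root, whose parent is a default value. *)
Definition child (v u : nat) : bool := (0 < u)%N && (par f u == v).

Definition kids (v : nat) : nat := \sum_(u < n.+1) child v u.

Definition leaf_kids (v : nat) : nat :=
  \sum_(u < n.+1) (child v u && (kids u == 0%N)).

Definition inner_kids (v : nat) : nat :=
  \sum_(u < n.+1) (child v u && (kids u != 0%N)).

Lemma kidsE (v : nat) : kids v = (leaf_kids v + inner_kids v)%N.
Proof.
rewrite /leaf_kids /inner_kids -big_split; apply: eq_bigr => u _.
by case: (child v u); case: (kids u == 0)%N.
Qed.

Lemma child_lt (v u : nat) : child v u -> (v < u)%N.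
Proof. by case/andP => u0 /eqP <-; apply: par_lt. Qed.

Lemma kids_gt0 (v : nat) :
  reflect (exists u : 'I_n.+1, child v u) (0 < kids v)%N.
Proof.
rewrite lt0n; apply: (iffP idP) => [|[u vu]].
  case: (boolP [exists u : 'I_n.+1, child v u]) => [/existsP //|].
  rewrite negb_exists => /forallP no; rewrite /kids big1 // => u _.
  by rewrite (negbTE (no u)).
by rewrite /kids (bigD1 u) //= vu.
Qed.

(** The neighbours of a node are its parent and its children, and these are
    distinct because labels increase away from the root. *)
Lemma sum_edge (Q : pred nat) (v : 'I_n.+1) :
  (\sum_(u < n.+1) (rrt_edge f v u && Q u))%N
  = (((0 < v)%N && Q (par f v)) + \sum_(u < n.+1) (child v u && Q u))%N.
Proof.
have -> : ((0 < v)%N && Q (par f v) : nat)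
        = (\sum_(u < n.+1) [&& (0 < v)%N, u == par f v :> nat & Q u])%N.
  case v0: (0 < v)%N; last by rewrite big1.
  have pn : (par f v < n.+1)%N by apply: ltn_trans (par_lt f v0) (ltn_ord v).
  rewrite (bigD1 (Ordinal pn)) //= eqxx /= big1 ?addn0 // => u.
  by rewrite -val_eqE /= => /negbTE ->.
rewrite -big_split; apply: eq_bigr => u _; rewrite rrt_edgeE /child /=.
rewrite [v == _ :> nat]eq_sym.
have : ~~ ([&& (0 < v)%N & u == par f v :> nat] &&
           [&& (0 < u)%N & par f u == v]).
  apply/negP => /andP[/andP[v0 /eqP uv] /andP[u0 /eqP vu]].
  by have := par_lt f v0; have := par_lt f u0; rewrite -uv vu; lia.
by case: (0 < v)%N; case: (0 < u)%N; case: (_ == _); case: (_ == _);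
  case: (Q u).
Qed.

(** The only child of the root, when there is one only: the one configuration in
    which the parent of a node is a leaf. *)
Definition stem (v : nat) : bool := (v == 1)%N && (kids 0 == 1)%N.

(** Leaves: apart from the root, every node already has its parent as a
    neighbour. *)
Definition barren (v : nat) : bool :=
  if v == 0%N then kids 0 == 1%N else kids v == 0%N.

Lemma leafE (v : 'I_n.+1) : leaf (rrt_edge f) v = barren v.
Proof.
rewrite /leaf /degree card_ord_pred.
under eq_bigr => u _ do rewrite -[rrt_edge f v u]andbT.
rewrite (sum_edge predT) /= andbT.
under eq_bigr => u _ do rewrite andbT.
rewrite -/(kids v) /barren; case: (nat_of_ord v) => [|k] //=.
Qed.

(** Node 1 is always a child of the root. *)
Lemma sole_child (v : nat) : (0 < n)%N -> (0 < v <= n)%N -> kids 0 = 1%N ->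
  (par f v == 0)%N = (v == 1)%N.
Proof.
move=> n0 /andP[v0 vn] k0.
have p1 : par f 1 = 0%N by have := par_lt f (isT : 0 < 1)%N; lia.
apply/eqP/eqP => [pv|-> //]; apply/eqP/negPn/negP => v1.
have i1 : (1 < n.+1)%N by [].
have iv : (v < n.+1)%N by [].
move: k0; rewrite /kids (bigD1 (Ordinal i1)) //= (bigD1 (Ordinal iv)) //=.
by rewrite /child /= p1 pv v0 eqxx.
Qed.

(** A parent other than the root has a parent and a child, so it is not a leaf.
    *)
Lemma par_barren (v : 'I_n.+1) : (0 < n)%N ->
  (0 < v)%N && barren (par f v) = stem v.
Proof.
move=> n0; rewrite /barren /stem; case: posnP => [-> //|v0] /=.
have vn : (0 < v <= n)%N by rewrite v0 -ltnS /=.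
case: eqP => [pv|/eqP pv].
  case: eqP => k0; last by rewrite andbF.
  by rewrite andbT -(sole_child n0 vn k0) pv.
have -> : (kids (par f v) == 0)%N = false.
  apply/negbTE; rewrite -lt0n; apply/kids_gt0.
  by exists v; rewrite /child v0 /=.
case: (kids 0 =P 1)%N => k0; last by rewrite andbF.
by rewrite andbT -(sole_child n0 vn k0) (negbTE pv).
Qed.

Lemma barren_neighbours (v : 'I_n.+1) : (0 < n)%N ->
  (\sum_(u < n.+1) (rrt_edge f v u && barren u))%N = (stem v + leaf_kids v)%N.
Proof.
move=> n0; rewrite sum_edge par_barren //; congr addn.
apply: eq_bigr => u _; rewrite /child /barren.
by case: (nat_of_ord u).
Qed.

Lemma fertile_neighbours (v : 'I_n.+1) : (0 < n)%N ->
  (\sum_(u < n.+1) (rrt_edge f v u && ~~ barren u))%N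
  = (((0 < v)%N && ~~ stem v) + inner_kids v)%N.
Proof.
move=> n0; rewrite (sum_edge (fun u => ~~ barren u)); congr addn.
  rewrite -(par_barren v n0).
  by case: (0 < v)%N => //=.
apply: eq_bigr => u _; rewrite /child /barren.
by case: (nat_of_ord u).
Qed.

Lemma rank0E (v : 'I_n.+1) : (rank (rrt_edge f) v == 0)%N = barren v.
Proof. by rewrite rank_eq0 leafE. Qed.

Lemma layer0E (v : 'I_n.+1) : (0 < n)%N ->
  (layer (rrt_edge f) v == 0)%N = barren v.
Proof. by move=> n0; rewrite layer_eq0 ?card_ord // leafE. Qed.

Lemma rank1E (v : 'I_n.+1) : (0 < n)%N ->
  (rank (rrt_edge f) v == 1)%N = ~~ barren v && (0 < stem v + leaf_kids v)%N.
Proof.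
move=> n0; rewrite rank_eq1 ?card_ord // leafE; congr andb.
rewrite -barren_neighbours // -card_ord_pred.
apply/existsP/card_gt0P => -[u]; rewrite ?leafE ?inE => H; exists u.
  by rewrite inE andbC.
by rewrite leafE andbC.
Qed.

Lemma inner_kids0_child (v : nat) (u : 'I_n.+1) :
  inner_kids v = 0%N -> child v u -> kids u = 0%N.
Proof.
rewrite /inner_kids (bigD1 u) //= => /eqP; rewrite addn_eq0 => /andP[].
by move=> + _ vu; rewrite vu eqb0 negbK => /eqP.
Qed.

(** A non-leaf all of whose neighbours are leaves is the root or the stem. Every
    larger node is then one of its children: the parent of a larger node would
    otherwise be larger too, hence by induction one of its children, and not a
    leaf. *)
Lemma star_shape (v : 'I_n.+1) : (0 < n)%N -> ~~ barren v ->
  [forall u : 'I_n.+1, (u != v) ==> barren u]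
  = (((0 < v)%N && ~~ stem v) + inner_kids v == 0)%N.
Proof.
move=> n0 fv; rewrite -fertile_neighbours //.
apply/forallP/eqP => [all_b|].
  apply: big1 => u _; have := all_b u; case: (eqVneq u v) => [->|_ /= ->].
    rewrite rrt_edgeE; case: posnP => //= v0.
    by have := par_lt f v0; case: eqP => // <-; rewrite ltnn.
  by rewrite andbF.
rewrite fertile_neighbours // => /eqP; rewrite addn_eq0 => /andP[sv /eqP iv].
have v1 : (v == 0 :> nat)%N || stem v.
  by move: sv; case: posnP => [->|_] //=; case: (stem v).
have below (w : nat) : (v < w <= n)%N -> par f w = v.
  elim/ltn_ind: w => w IHw /andP[vw wn].
  have w0 : (0 < w)%N by apply: leq_trans vw.
  have pw := par_lt f w0.
  case: (ltngtP (par f w) v) => // [pv|vp].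
    move: v1 pv; case: eqP => [-> //|_] /andP[/eqP v1 /eqP k0]; rewrite v1.
    rewrite ltnS leqn0 (sole_child n0 _ k0) ?w0 // => /eqP w1.
    by move: vw; rewrite v1 w1.
  have pn : (par f w < n.+1)%N by lia.
  have pp : par f (par f w) = v by apply: IHw => //; lia.
  have := @inner_kids0_child v (Ordinal pn) iv.
  rewrite /child /= pp eqxx andbT => /(_ (leq_ltn_trans (leq0n _) vp)) kp.
  have : (0 < kids (par f w))%N.
    have wn' : (w < n.+1)%N by [].
    by apply/kids_gt0; exists (Ordinal wn'); rewrite /child w0 /=.
  by rewrite kp.
move=> u; apply/implyP => uv; case: (ltngtP u v) => [uv'|vu|uv'].
- move: v1 uv'; case: eqP => [-> //|_] /andP[/eqP -> /eqP k0].
  by rewrite ltnS leqn0 /barren => ->; rewrite k0.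
- have u0 : (0 < u)%N by apply: leq_trans vu.
  rewrite /barren -[u == _ :> nat]negbK -lt0n u0 /=.
  apply/eqP/(inner_kids0_child iv).
  by rewrite /child u0 below ?vu //= -ltnS.
- by move: uv; rewrite -val_eqE /= uv' eqxx.
Qed.

Lemma layer1E (v : 'I_n.+1) : (0 < n)%N ->
  (layer (rrt_edge f) v == 1)%N
  = ~~ barren v && (((0 < v)%N && ~~ stem v) + inner_kids v <= 1)%N.
Proof.
move=> n0; rewrite layer_eq1 ?card_ord // leafE; apply: andb_id2l => fv.
under eq_forallb => u do rewrite leafE.
rewrite star_shape // -fertile_neighbours // card_ord_pred.
under eq_bigr => u _ do rewrite leafE.
by case: (\sum_(u < _) _)%N => [|[]].
Qed.

(** Node 2 is not a second child of the root, so it is a child of node 1. *)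
Lemma stem_kids : (1 < n)%N -> (kids 0 == 1)%N -> (0 < kids 1)%N.
Proof.
move=> n1 /eqP k0; have n0 : (0 < n)%N by apply: ltnW.
have i2 : (2 < n.+1)%N by [].
apply/kids_gt0; exists (Ordinal i2); rewrite /child /=.
have p2 : par f 2 != 0%N by rewrite (sole_child n0 _ k0).
by have := par_lt f (isT : 0 < 2)%N; case: (par f 2) p2 => [|[]].
Qed.

Lemma stem_leaf_kids0 : (1 < n)%N -> (kids 0 == 1)%N -> leaf_kids 0 = 0%N.
Proof.
move=> n1 k0; have n0 : (0 < n)%N by apply: ltnW.
apply: big1 => u _; case: (boolP (child 0 u)) => //= /andP[u0 pu].
have un : (0 < u <= n)%N by rewrite u0 -ltnS /=.
move: pu; rewrite (sole_child n0 un (eqP k0)) => /eqP ->.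
by have := stem_kids n1 k0; case: (kids 1).
Qed.

Lemma count_nodes (Q : pred nat) :
  #|[set v : 'I_n.+1 | Q v]| = (Q 0%N + \sum_(v < n) Q v.+1)%N.
Proof. by rewrite card_ord_pred big_ord_recl. Qed.

Lemma sum_stem (F : nat -> bool) : (0 < n)%N ->
  (\sum_(v < n) (stem v.+1 && F v.+1) = ((kids 0 == 1) && F 1))%N.
Proof.
case: n => // m _; rewrite big_ord_recl /= /stem /= big1 ?addn0 // => v _.
Qed.

Lemma nb_rank0E :
  nb_rank 0 f = ((kids 0 == 1) + \sum_(v < n) (kids v.+1 == 0))%N.
Proof.
rewrite /nb_rank -(count_nodes barren); apply: eq_card => v.
by rewrite !inE rank0E.
Qed.

Lemma nb_layer0E : (0 < n)%N ->
  nb_layer 0 f = ((kids 0 == 1) + \sum_(v < n) (kids v.+1 == 0))%N.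
Proof.
move=> n0; rewrite /nb_layer -(count_nodes barren); apply: eq_card => v.
by rewrite !inE layer0E.
Qed.

(** The last term is for a stem without childless children, which is next to a
    leaf because the root is one. The first term needs no test that the root is
    not a leaf: with one child, that child has children of its own. *)
Lemma nb_rank1E : (1 < n)%N ->
  nb_rank 1 f = ((0 < leaf_kids 0) + \sum_(v < n) (0 < leaf_kids v.+1)
                 + ((kids 0 == 1) && (leaf_kids 1 == 0)))%N.
Proof.
move=> n1; have n0 : (0 < n)%N by apply: ltnW.
transitivity #|[set v : 'I_n.+1 | ~~ barren v && (0 < stem v + leaf_kids v)%N]|.
  by apply: eq_card => v; rewrite !inE rank1E.
rewrite (count_nodes (fun v => ~~ barren v && (0 < stem v + leaf_kids v)%N)).
rewrite -addnA; congr addn.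
  rewrite /barren /stem /= add0n.
  case: (boolP (kids 0 == 1)%N) => //= k0.
  by rewrite stem_leaf_kids0.
rewrite -(sum_stem (fun v => leaf_kids v == 0%N)) // -big_split.
apply: eq_bigr => v _; rewrite /barren /=.
case: (boolP (stem v.+1)) => [/andP[/eqP -> k0]|_] /=.
  rewrite -lt0n (stem_kids n1 k0) /=; case: (leaf_kids 1) => //.
by rewrite kidsE; case: (leaf_kids _) => [|m]; rewrite ?andbF ?andbT.
Qed.

(** The last term is for a stem keeping one non-leaf child after the root is
    stripped; a stem keeping none is an ordinary star and is counted in the sum.
    *)
Lemma nb_layer1E : (1 < n)%N ->
  nb_layer 1 f = (((kids 0 != 1) && (inner_kids 0 <= 1))
                  + \sum_(v < n)
                      ((0 < leaf_kids v.+1) && (inner_kids v.+1 == 0))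
                  + ((kids 0 == 1) && (inner_kids 1 == 1)))%N.
Proof.
move=> n1; have n0 : (0 < n)%N by apply: ltnW.
transitivity #|[set v : 'I_n.+1 | ~~ barren v &&
                 (((0 < v)%N && ~~ stem v) + inner_kids v <= 1)%N]|.
  by apply: eq_card => v; rewrite !inE layer1E.
rewrite (count_nodes (fun v => ~~ barren v &&
                 (((0 < v)%N && ~~ stem v) + inner_kids v <= 1)%N)).
rewrite -addnA; congr addn.
rewrite -(sum_stem (fun v => inner_kids v == 1%N)) // -big_split.
apply: eq_bigr => v _; rewrite /barren /=.
case: (boolP (stem v.+1)) => [/andP[/eqP -> k0]|_] /=.
  have := stem_kids n1 k0; rewrite -lt0n => k1; rewrite k1 /=.
  move: k1; rewrite kidsE.
  by case: (leaf_kids 1) (inner_kids 1) => [|l] [|[|i]].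
by rewrite kidsE; case: (leaf_kids _) (inner_kids _) => [|l] [|[|i]].
Qed.

End Shape.

(** * Growing a tree by one node *)

(** The value always fits in 'I_t.+1, so that inord keeps it (growE). *)
Definition grow (n : nat) (f : history n.+1) (u : 'I_n.+1) : history n.+2 :=
  [ffun t : 'I_n.+1 => (inord (if (t < n)%N then par f t.+1 else u) : 'I_t.+1)].

Definition prune (n : nat) (g : history n.+2) : history n.+1 :=
  [ffun t : 'I_n => (g (widen_ord (leqnSn n) t) : 'I_t.+1)].

Lemma par_succ (n : nat) (f : history n.+1) (t : 'I_n) : par f t.+1 = f t.
Proof.
rewrite /par /=; case: insubP => [s _ st|]; last by rewrite ltn_ord.
by have -> : s = t by apply: val_inj.
Qed.

Lemma growE (n : nat) (f : history n.+1) (u : 'I_n.+1) (t : 'I_n.+1) :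
  grow f u t = (if (t < n)%N then par f t.+1 else u) :> nat.
Proof.
rewrite ffunE inordK //; case: (ltnP t n) => [tn|nt]; first exact: par_lt.
by apply: leq_trans (ltn_ord u) _.
Qed.

Lemma par_grow (n : nat) (f : history n.+1) (u : 'I_n.+1) (x : nat) :
  (0 < x <= n.+1)%N ->
  par (grow f u) x = if x == n.+1 then u : nat else par f x.
Proof.
case: x => // x /= xn; rewrite (par_succ (grow f u) (Ordinal xn)) growE /=.
by rewrite eqSS ltn_neqAle -ltnS xn andbT; case: eqP.
Qed.

(** This is what lets expectations be computed one attachment at a time. *)
Lemma grow_bij (n : nat) :
  bijective (fun fu : history n.+1 * 'I_n.+1 => grow fu.1 fu.2).
Proof.
exists (fun g : history n.+2 => (prune g, g ord_max : 'I_n.+1)) => [[f u]|g] /=.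
  have gu := growE f u ord_max; rewrite ltnn in gu.
  congr pair; last by apply: val_inj.
  apply/ffunP => t; apply: val_inj.
  rewrite ffunE; apply: etrans (growE f u (widen_ord _ t)) _.
  by rewrite /= ltn_ord par_succ.
have gE (s t : 'I_n.+1) : s = t -> g s = g t :> nat by move=> ->.
apply/ffunP => t; apply: val_inj; apply: etrans (growE _ _ _) _.
case: ltnP => [tn|nt].
  rewrite (par_succ (prune g) (Ordinal tn)) ffunE.
  exact/gE/val_inj.
apply/gE/val_inj => /=; apply/eqP.
by rewrite eqn_leq nt -ltnS /=.
Qed.

Section Step.
Variables (n : nat) (f : history n.+1).
Implicit Type u v x : nat.

Definition leaf_child v u : bool := child f v u && (kids f u == 0%N).

Lemma child_grow (u : 'I_n.+1) v x :
  (x <= n.+1)%N ->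
  child (grow f u) v x = if x == n.+1 then u == v :> nat else child f v x.
Proof.
rewrite /child; case: x => [|x] xn //=.
by rewrite par_grow //; case: (_ == n.+1).
Qed.

Lemma kids_grow (u : 'I_n.+1) v :
  kids (grow f u) v = (kids f v + (u == v :> nat))%N.
Proof.
rewrite /kids big_ord_recr /= child_grow // eqxx; congr addn.
apply: eq_bigr => x _; rewrite child_grow 1?ltnW //= ?ltnS 1?ltnW //.
by rewrite ltn_eqF.
Qed.

Lemma kids_ge v : (n < v)%N -> kids f v = 0%N.
Proof.
move=> nv; apply: big1 => x _; case: (boolP (child _ _ _)) => // /child_lt vx.
by have := ltn_ord x; lia.
Qed.

(** Additive form of a count that decreases when the new node is attached to a
    childless child of v. *)
Lemma leaf_kids_grow (u : 'I_n.+1) v : (v <= n)%N ->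
  (leaf_kids (grow f u) v + leaf_child v u = leaf_kids f v + (u == v :> nat))%N.
Proof.
move=> vn; rewrite {1}/leaf_kids big_ord_recr /= child_grow // eqxx.
have -> : kids (grow f u) n.+1 = 0%N by rewrite kids_grow kids_ge // ltn_eqF.
rewrite eqxx andbT addnAC; congr addn.
rewrite /leaf_kids (bigD1 u) //= [in RHS](bigD1 u) //= -/(leaf_child v u).
rewrite kids_grow eqxx addn1 andbF add0n addnC; congr addn.
apply: eq_bigr => x xu; have xn := ltn_ord x.
rewrite child_grow ?kids_grow 1?ltnW // ltn_eqF //=.
have -> : (u == x :> nat) = false by rewrite eq_sym; apply: negbTE.
by rewrite addn0.
Qed.

Lemma inner_kids_grow (u : 'I_n.+1) v : (v <= n)%N ->
  (inner_kids (grow f u) v = inner_kids f v + leaf_child v u)%N.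
Proof.
move=> vn; have := leaf_kids_grow u vn; have := kids_grow u v.
by rewrite !kidsE; lia.
Qed.

Lemma leaf_child_irr v : leaf_child v v = false.
Proof. by apply/negbTE/negP => /andP[/child_lt]; rewrite ltnn. Qed.

Section Drift.
Variable R : realType.

(** For a node in the state (l, i) of a tree with m nodes, m times the mean of G
    at its state after one attachment: to the node itself, to one of its l
    childless children, or to one of the m - 1 - l remaining nodes. When l = 0
    the truncated predecessor comes with the factor 0. *)
Definition drift (m : R) (G : nat -> nat -> R) (l i : nat) : R :=
  G l.+1 i + l%:R * G l.-1 i.+1 + (m - 1 - l%:R) * G l i.

Lemma grow_state (G : nat -> nat -> R) (u : 'I_n.+1) v : (v <= n)%N ->
  G (leaf_kids (grow f u) v) (inner_kids (grow f u) v)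
  = G (leaf_kids f v) (inner_kids f v)
    + (u == v :> nat)%:R
      * (G (leaf_kids f v).+1 (inner_kids f v)
         - G (leaf_kids f v) (inner_kids f v))
    + (leaf_child v u)%:R
      * (G (leaf_kids f v).-1 (inner_kids f v).+1
         - G (leaf_kids f v) (inner_kids f v)).
Proof.
move=> vn; rewrite (inner_kids_grow u vn); have := leaf_kids_grow u vn.
case: (eqVneq (u : nat) v) => [->|_].
  rewrite leaf_child_irr /= !addn0 addn1 => ->; ring.
case: (leaf_child v u) => /=; rewrite ?addn0 ?addn1 => <- /=; ring.
Qed.

Lemma sum_grow_state (G : nat -> nat -> R) v : (v <= n)%N ->
  \sum_(u < n.+1) G (leaf_kids (grow f u) v) (inner_kids (grow f u) v)
  = drift n.+1%:R G (leaf_kids f v) (inner_kids f v).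
Proof.
move=> vn; under eq_bigr => u _ do rewrite grow_state //.
rewrite 2!big_split /= -!mulr_suml -!natr_sum sumr_const card_ord.
rewrite -/(leaf_kids f v).
have -> : (\sum_(u < n.+1) (u == v :> nat) = 1)%N.
  have vn' : (v < n.+1)%N by [].
  rewrite (bigD1 (Ordinal vn')) //= eqxx big1 // => u.
  by rewrite -val_eqE /= => /negbTE ->.
rewrite /drift -[G _ _ *+ _]mulr_natl; ring.
Qed.

End Drift.
End Step.

Section Expect.
Variable R : realType.

Lemma rrt_expectS (n : nat) (X : history n.+2 -> R) :
  rrt_expect X
  = rrt_expect (fun f : history n.+1 =>
                  n.+1%:R^-1 * \sum_(u < n.+1) X (grow f u)).
Proof.
rewrite /rrt_expect (reindex _ (onW_bij _ (grow_bij n))) /=.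
rewrite -(pair_bigA _ (fun f u => rrt_prob R (grow f u) * X (grow f u))) /=.
apply: eq_bigr => f _; rewrite mulrA big_distrr /=; apply: eq_bigr => u _.
by congr (_ * _); rewrite /rrt_prob /= big_ord_recr.
Qed.

Lemma rrt_expect1 (X : history 1 -> R) (c : R) :
  (forall f, X f = c) -> rrt_expect X = c.
Proof.
move=> Xc; rewrite /rrt_expect.
have f0 : history 1 by apply: finfun => -[].
rewrite (bigD1 f0) //= big1 => [|g].
  by rewrite addr0 Xc /rrt_prob big_ord0 mul1r.
by case/eqP; apply/ffunP => -[].
Qed.

Lemma rrt_expectD (n : nat) (X Y : history n -> R) :
  rrt_expect (fun f => X f + Y f) = rrt_expect X + rrt_expect Y.
Proof.
by rewrite /rrt_expect -big_split; apply: eq_bigr => f _; rewrite mulrDr.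
Qed.

Lemma rrt_expectZ (n : nat) (c : R) (X : history n -> R) :
  rrt_expect (fun f => c * X f) = c * rrt_expect X.
Proof.
by rewrite /rrt_expect big_distrr; apply: eq_bigr => f _; rewrite mulrCA.
Qed.

Lemma eq_rrt_expect (n : nat) (X Y : history n -> R) :
  (forall f, X f = Y f) -> rrt_expect X = rrt_expect Y.
Proof. by move=> XY; apply: eq_bigr => f _; rewrite XY. Qed.

Lemma rrt_expect_sum (n : nat) (I : Type) (r : seq I) (P : pred I)
    (X : I -> history n -> R) :
  rrt_expect (fun f => \sum_(j <- r | P j) X j f)
  = \sum_(j <- r | P j) rrt_expect (X j).
Proof.
rewrite /rrt_expect exchange_big; apply: eq_bigr => f _.
by rewrite big_distrr.
Qed.

End Expect.

(** * Recurrences for means of functions of the state *)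

Lemma leaf_kids_le (n : nat) (f : history n.+1) (v : nat) :
  (leaf_kids f v <= n)%N.
Proof.
rewrite /leaf_kids big_ord_recl /= {1}/child /= add0n.
apply: (@leq_trans (\sum_(u < n) 1)%N); last by rewrite sum1_card card_ord.
by apply: leq_sum => u _; apply: leq_b1.
Qed.

Section Census.
Variable R : realType.
Implicit Types (A : pred nat) (G H : nat -> nat -> R).

(** The root and the other nodes follow the same recurrence, so a single
    definition serves both, with A selecting the nodes. *)
Definition census A (n : nat) G : R :=
  rrt_expect (fun f : history n.+1 =>
    \sum_(v < n.+1 | A v) G (leaf_kids f v) (inner_kids f v)).

Lemma rrt_expect_cst (n : nat) (c : R) :
  rrt_expect (fun f : history n.+1 => c) = c.
Proof.
elim: n => [|n IHn]; first exact: rrt_expect1.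
rewrite rrt_expectS -[RHS]IHn; apply: eq_rrt_expect => f.
by rewrite sumr_const card_ord -[c *+ _]mulr_natl mulKf // pnatr_eq0.
Qed.

Lemma census0 A G : census A 0 G = (A 0%N)%:R * G 0%N 0%N.
Proof.
apply: rrt_expect1 => f; rewrite big_mkcond big_ord_recl /= big_ord0 addr0.
have kids0 : kids f 0 = 0%N by rewrite /kids big_ord_recl big_ord0 /= /child.
move: kids0; rewrite kidsE => /eqP; rewrite addn_eq0 => /andP[/eqP -> /eqP ->].
by case: (A 0%N); rewrite ?mul1r ?mul0r.
Qed.

(** The old nodes contribute the drift; the new node has no children. *)
Lemma censusS A (n : nat) G :
  census A n.+1 G
  = n.+1%:R^-1 * census A n (drift n.+1%:R G) + (A n.+1)%:R * G 0%N 0%N.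
Proof.
rewrite /census rrt_expectS -rrt_expectZ.
rewrite -[(A n.+1)%:R * _](rrt_expect_cst n) -rrt_expectD.
apply: eq_rrt_expect => f; rewrite exchange_big /= big_mkcond big_ord_recr /=.
rewrite -big_mkcond /= mulrDr; congr (_ + _).
  congr (_ * _); apply: eq_bigr => v _; apply: sum_grow_state.
  by rewrite -ltnS /=.
case: (A n.+1); last by rewrite mulr0 mul0r.
under eq_bigr => u _.
  have -> : leaf_kids (grow f u) n.+1 = 0%N.
    have := kids_grow f u n.+1; rewrite kidsE kids_ge // (ltn_eqF (ltn_ord u)).
    by move/eqP; rewrite addn_eq0 => /andP[/eqP].
  have -> : inner_kids (grow f u) n.+1 = 0%N.
    have := kids_grow f u n.+1; rewrite kidsE kids_ge // (ltn_eqF (ltn_ord u)).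
    by move/eqP; rewrite addn_eq0 => /andP[_ /eqP].
  over.
by rewrite sumr_const card_ord mul1r -[G _ _ *+ _]mulr_natl mulKf // pnatr_eq0.
Qed.

Lemma eq_census A (n : nat) G H :
  (forall l i, (l <= n)%N -> G l i = H l i) -> census A n G = census A n H.
Proof.
move=> GH; apply: eq_rrt_expect => f; apply: eq_bigr => v _.
by rewrite GH // leaf_kids_le.
Qed.

Lemma census_lin A (n : nat) (a b : R) G H :
  census A n (fun l i => a * G l i + b * H l i)
  = a * census A n G + b * census A n H.
Proof.
rewrite /census -!rrt_expectZ -rrt_expectD; apply: eq_rrt_expect => f.
by rewrite big_split /= -!big_distrr.
Qed.

Lemma census_sum A (n m : nat) (a : nat -> R) (G : nat -> nat -> nat -> R) :
  census A n (fun l i => \sum_(j < m) a j * G j l i)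
  = \sum_(j < m) a j * census A n (G j).
Proof.
rewrite /census; under [RHS]eq_bigr => j _ do rewrite -rrt_expectZ.
rewrite -rrt_expect_sum; apply: eq_rrt_expect => f.
by rewrite exchange_big; apply: eq_bigr => j _; rewrite big_distrr.
Qed.

Definition root_mean n G := census (pred1 0%N) n G.
Definition rest_mean n G := census (fun v => 0 < v)%N n G.
(** The node 1 is the stem exactly when the root has one child. *)
Definition stem_mean n G : R :=
  rrt_expect (fun f : history n.+1 =>
    (kids f 0 == 1%N)%:R * G (leaf_kids f 1) (inner_kids f 1)).

Lemma root_meanE n G :
  root_mean n G
  = rrt_expect (fun f : history n.+1 => G (leaf_kids f 0) (inner_kids f 0)).
Proof.
apply: eq_rrt_expect => f; rewrite big_mkcond big_ord_recl /= big1 ?addr0 //.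
Qed.

Lemma rest_meanE n G :
  rest_mean n G
  = rrt_expect (fun f : history n.+1 =>
      \sum_(v < n) G (leaf_kids f v.+1) (inner_kids f v.+1)).
Proof.
by apply: eq_rrt_expect => f; rewrite big_mkcond big_ord_recl /= add0r.
Qed.

(** Given that the root has one child, the later nodes attach uniformly above
    that child and build a recursive tree on n.+1 nodes. In terms of
    recurrences: one of the n.+2 choices, the root, destroys the event and would
    have left the state of node 1 unchanged, so what remains is the drift for
    n.+1 nodes. *)
Lemma stem_meanE n G : stem_mean n.+1 G = n.+1%:R^-1 * root_mean n G.
Proof.
have kids2 (f : history 2) : kids f 0 = 1%N.
  rewrite /kids !big_ord_recl big_ord0 /= /child /=.
  by have := par_lt f (isT : 0 < 1)%N; case: (par f 1).
elim: n G => [|n IHn] G.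
  rewrite /root_mean census0 /stem_mean rrt_expectS /= invr1 !mul1r.
  apply: rrt_expect1 => f; rewrite big_ord_recl big_ord0 addr0 kids2 !mul1r.
  have : kids (grow f ord0) 1 = 0%N by rewrite kids_grow kids_ge.
  rewrite kidsE => /eqP; rewrite addn_eq0 => /andP[/eqP -> /eqP ->].
  by [].
rewrite /root_mean censusS /= mul0r addr0 -/(root_mean _ _) -IHn.
rewrite {1}/stem_mean rrt_expectS -rrt_expectZ; apply: eq_rrt_expect => f.
congr (_ * _); rewrite big_ord_recl /= kids_grow addn1 eqSS.
have -> : (kids f 0 == 0%N) = false.
  apply/negbTE; rewrite -lt0n; apply/kids_gt0.
  exists (Ordinal (isT : 1 < n.+2)%N); rewrite /child /=.
  by have := par_lt f (isT : 0 < 1)%N; case: (par f 1).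
rewrite mul0r add0r.
under eq_bigr => u _ do rewrite kids_grow /= addn0.
rewrite -big_distrr /=; congr (_ * _).
have := sum_grow_state f G (isT : 1 <= n.+1)%N.
rewrite big_ord_recl grow_state //= /leaf_child /= !mul0r !addr0 => E.
rewrite -[LHS](addKr (G (leaf_kids f 1) (inner_kids f 1))) E.
rewrite /drift -[n.+2%:R]natr1; ring.
Qed.

End Census.

(** * Binomial moments and probabilities of small configurations *)

Section Means.
Variable R : realType.

Definition binl (k l i : nat) : R := 'C(l, k)%:R.
(** The subtree of the node is a star with j rays centred at the node. *)
Definition star_at (j l i : nat) : R := ((l == j) && (i == 0))%N%:R.
(** All children but one are childless, and there are j of these. *)
Definition near_star_at (j l i : nat) : R := ((l == j) && (i == 1))%N%:R.

(** Pascal's rule for the first term of the drift and l * 'C(l - 1, k) = (k + 1)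
    * 'C(l, k + 1) for the second make the system triangular in k. *)
Lemma drift_binl (m : R) (k l i : nat) :
  drift m (binl k.+1) l i = (m - k.+1%:R) * binl k.+1 l i + binl k l i.
Proof.
rewrite /drift /binl binS natrD.
case: l => [|l] /=; first by rewrite !bin0n /=; ring.
have E : (l.+1%:R * 'C(l, k)%:R : R) = k.+1%:R * 'C(l.+1, k.+1)%:R.
  by rewrite -!natrM mul_bin_diag.
have F : ('C(l.+1, k.+1)%:R : R) = 'C(l, k.+1)%:R + 'C(l, k)%:R.
  by rewrite binS natrD.
have -> : 'C(l, k.+1)%:R = 'C(l.+1, k.+1)%:R - 'C(l, k)%:R :> R.
  by rewrite F addrK.
rewrite mulrBr E; ring.
Qed.

Lemma drift_binl0 (m : R) (l i : nat) : drift m (binl 0) l i = m * binl 0 l i.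
Proof. rewrite /drift /binl !bin0; ring. Qed.

Lemma drift_star_at (m : R) (j l i : nat) :
  drift m (star_at j) l i
  = (0 < j)%N%:R * star_at j.-1 l i + (m - 1 - j%:R) * star_at j l i.
Proof.
rewrite /drift /star_at andbF mulr0 addr0; congr (_ + _).
  by case: j => [|j]; rewrite ?mul0r //= mul1r eqSS.
by case: eqP => [->|] //; rewrite !mulr0.
Qed.

Lemma drift_near_star_at (m : R) (j l i : nat) :
  drift m (near_star_at j) l i
  = ((0 < j)%N%:R * near_star_at j.-1 l i
     + (m - 1 - j%:R) * near_star_at j l i) + j.+1%:R * star_at j.+1 l i.
Proof.
rewrite /drift /star_at /near_star_at addrAC; congr (_ + _ + _).
- by case: j => [|j]; rewrite ?mul0r //= mul1r eqSS.
- by case: eqP => [->|] //; rewrite !mulr0.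
- case: l => [|l]; rewrite ?mul0r ?mulr0 //= !eqSS.
  by case: eqP => [->|] //; rewrite !mulr0.
Qed.

Lemma natr_fact_neq0 (n : nat) : (n`!%:R : R) != 0.
Proof. by rewrite pnatr_eq0 -lt0n fact_gt0. Qed.

Lemma natrS_neq0 (n : nat) : (n.+1%:R : R) != 0.
Proof. by rewrite pnatr_eq0. Qed.

Lemma census_drift (A : pred nat) (n : nat) (a b : R) (G H : nat -> nat -> R) :
  (forall l i, drift n.+1%:R G l i = a * G l i + b * H l i) ->
  census A n (drift n.+1%:R G) = a * census A n G + b * census A n H.
Proof. by move=> E; rewrite -census_lin; apply: eq_census. Qed.

Lemma census_binl0S (A : pred nat) (n : nat) :
  census A n.+1 (binl 0) = census A n (binl 0) + (A n.+1)%:R.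
Proof.
rewrite censusS /binl bin0 mulr1 -/(binl 0).
rewrite (@census_drift _ _ n.+1%:R 0 _ (binl 0)) => [|l i].
  by rewrite mul0r addr0 mulKf // natrS_neq0.
by rewrite drift_binl0 mul0r addr0.
Qed.

Lemma census_binlS (A : pred nat) (n k : nat) :
  census A n.+1 (binl k.+1)
  = n.+1%:R^-1 * ((n%:R - k%:R) * census A n (binl k.+1) + census A n (binl k)).
Proof.
rewrite censusS /binl bin0n mulr0 addr0 -/(binl k.+1) -/(binl k).
rewrite (@census_drift _ _ (n%:R - k%:R) 1 _ (binl k)) ?mul1r // => l i.
by rewrite drift_binl -2!natr1; ring.
Qed.

(** The binomial moments of the number of fixed points of a uniform permutation
    of n points. *)
Lemma root_binl (k n : nat) :
  root_mean n (binl k) = (k <= n)%N%:R / k`!%:R.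
Proof.
rewrite /root_mean; elim: n k => [|n IHn] k.
  by rewrite census0 /= /binl bin0n leqn0 mul1r; case: k => [|k];
    rewrite ?mul0r // fact0 divr1.
case: k => [|k]; first by rewrite census_binl0S IHn addr0.
rewrite census_binlS !IHn ltnS factS natrM.
have := natr_fact_neq0 k; have := natrS_neq0 n; have := natrS_neq0 k.
case: (ltngtP k n) => [kn|kn|->] /=.
- by rewrite -!natr1; move=> *; field; apply/and3P.
- by rewrite !mul0r mulr0 addr0 mulr0.
- by rewrite subrr mul0r add0r; move=> *; field; apply/andP.
Qed.

(** The truncated subtraction encodes the boundary: at least k.+2 nodes are
    needed for a node other than the root to have k children. *)
Lemma rest_binl (k n : nat) :
  rest_mean n (binl k) = (n - k)%N%:R / k.+1`!%:R.
Proof.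
rewrite /rest_mean; elim: n k => [|n IHn] k; first by rewrite census0 /= !mul0r.
case: k => [|k]; first by rewrite census_binl0S IHn !subn0 !divr1 natr1.
rewrite census_binlS !IHn subSS 2!factS !natrM.
have := natr_fact_neq0 k; have := natrS_neq0 n.
have := natrS_neq0 k; have := natrS_neq0 k.+1.
case: (leqP n k) => nk.
  have -> : (n - k = 0)%N by apply/eqP.
  have -> : (n - k.+1 = 0)%N by apply/eqP; apply: leqW.
  by rewrite !mul0r mulr0 addr0 mulr0.
rewrite !natrB // 1?ltnW // -!natr1; move=> *; field.
by apply/and4P.
Qed.

Lemma census_star_atS (A : pred nat) (n j : nat) :
  census A n.+1 (star_at j)
  = n.+1%:R^-1 * ((0 < j)%N%:R * census A n (star_at j.-1)
                  + (n%:R - j%:R) * census A n (star_at j))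
    + ((A n.+1) && (j == 0))%N%:R.
Proof.
rewrite censusS (@census_drift _ _ (n%:R - j%:R) (0 < j)%N%:R _ (star_at j.-1)).
  rewrite [X in _ * X + _]addrC; congr (_ + _).
  by rewrite /star_at /= andbT eq_sym; case: (A _); rewrite ?mul1r ?mul0r.
by move=> l i; rewrite drift_star_at addrC -natr1 addrK.
Qed.

(** The probability that a uniform permutation of n points has j fixed points
    and no longer cycle. *)
Lemma root_star_at (j n : nat) :
  root_mean n (star_at j) = (j == n)%:R / j`!%:R.
Proof.
rewrite /root_mean; elim: n j => [|n IHn] j.
  by rewrite census0 /star_at /= andbT mul1r eq_sym; case: j => [|j];
    rewrite ?mul0r // fact0 divr1.
rewrite census_star_atS !IHn /= addr0.
case: j => [|j] /=.
  by case: n {IHn} => [|n]; rewrite !(mul0r, subrr, mulr0, addr0).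
rewrite mul1r eqSS.
have -> : (n%:R - j.+1%:R) * ((j.+1 == n)%:R / j.+1`!%:R) = 0 :> R.
  by case: eqP => [->|_]; rewrite ?subrr !mul0r ?mulr0.
case: eqP => [->|_]; last by rewrite !mul0r addr0 mulr0.
by rewrite addr0 factS natrM !mul1r invfM mulrC.
Qed.

(** The factor n.+1, the number of nodes, is the exact solution as soon as j.+2
    nodes make the configuration possible; the value there fixes the constant.
    *)
Lemma rest_star_at (j n : nat) :
  rest_mean n (star_at j) = (j < n)%N%:R * (n.+1%:R / j.+2`!%:R).
Proof.
rewrite /rest_mean; elim: n j => [|n IHn] j; first by rewrite census0 /= !mul0r.
rewrite census_star_atS !IHn /=.
have := natr_fact_neq0 j; have := natrS_neq0 n.
have := natrS_neq0 j; have := natrS_neq0 j.+1.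
case: j => [|j] /=.
  case: n {IHn} => [|n] /=; last first.
    by move=> *; rewrite -!natr1; field; rewrite natr1.
  by move=> *; rewrite !mul0r mulr0 addr0 mulr0 add0r mul1r divff.
rewrite addr0 ltnS [j.+3`!]factS natrM => j3 j2 n1 fj.
have f2 := natr_fact_neq0 j.+2.
case: (ltngtP j.+1 n) => [kn|kn|->] /=.
- by rewrite -!natr1; field; rewrite ?natr1; apply/and3P.
- by rewrite !(mul0r, mulr0, addr0).
- have f1 := natr_fact_neq0 n.+1.
  by rewrite -!natr1; field; rewrite ?natr1; apply/and3P.
Qed.

Lemma census_near_star_atS (A : pred nat) (n j : nat) :
  census A n.+1 (near_star_at j)
  = n.+1%:R^-1 * ((0 < j)%N%:R * census A n (near_star_at j.-1)
                  + (n%:R - j%:R) * census A n (near_star_at j)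
                  + j.+1%:R * census A n (star_at j.+1)).
Proof.
rewrite censusS [near_star_at j 0 0]/near_star_at andbF mulr0 addr0.
congr (_ * _); rewrite -census_lin -[X in _ = X + _]mul1r -census_lin.
apply: eq_census => l i _.
by rewrite drift_near_star_at -[n.+1%:R]natr1 addrK mul1r.
Qed.

(** The probability that a uniform permutation of n points consists of j fixed
    points and one cycle of length n - j >= 2. *)
Lemma root_near_star_at (j n : nat) :
  root_mean n (near_star_at j)
  = (j.+1 < n)%N%:R / (j`!%:R * (n%:R - j%:R)).
Proof.
rewrite /root_mean; elim: n j => [|n IHn] j.
  by rewrite census0 /near_star_at andbF mulr0 mul0r.
rewrite census_near_star_atS !IHn -/(root_mean n (star_at _)) root_star_at.
rewrite ltnS.
have subn_unit (a b : nat) : (a < b)%N -> (b%:R - a%:R : R) != 0.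
  by move=> ab; rewrite subr_eq0 eqr_nat gtn_eqF.
case: j => [|j] /=.
  rewrite !subr0 !mul0r add0r !mul1r.
  case: n {IHn} => [|[|n]] /=; rewrite ?(mul0r, mulr0, addr0) //.
    by rewrite divr1 add0r mul1r mulr1.
  by rewrite div1r mulfV ?natrS_neq0 // mulr1 div1r.
have fj := natr_fact_neq0 j; have j1 := natrS_neq0 j; have n1 := natrS_neq0 n.
rewrite !factS !natrM mul1r.
case: (ltngtP j.+2 n) => [jn|jn|nE] /=.
- have := subn_unit j n (ltnW (ltnW jn)); have := subn_unit j.+1 n (ltnW jn).
  have := subn_unit j.+1 n.+1 (leqW (ltnW jn)).
  rewrite -!natr1 => u1 u2 u3; rewrite -natr1 in j1.
  by field; rewrite u1 u2 fj !natr1 !natrS_neq0.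
- by rewrite !(mul0r, mulr0, addr0).
- rewrite -nE in n1 *; have j2 := natrS_neq0 j.+1.
  have -> : j.+2%:R - j%:R = 2 :> R by rewrite -!natr1; ring.
  have -> : j.+3%:R - j.+1%:R = 2 :> R by rewrite -!natr1; ring.
  have := subn_unit j.+1 j.+2 (leqnn _); rewrite -!natr1 => u.
  by field; rewrite u fj !natr1 !natrS_neq0.
Qed.

End Means.

(** * Expected numbers of nodes of rank and layer zero and one *)

Section Exact.
Variable R : realType.

(** Partial sum of the exponential series, with n terms. *)
Definition expsum (x : R) (n : nat) : R := \sum_(0 <= k < n) x ^+ k / k`!%:R.

Lemma expsumS (x : R) (n : nat) : expsum x n.+1 = expsum x n + x ^+ n / n`!%:R.
Proof. by rewrite /expsum big_nat_recr. Qed.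

Definition no_leaf_kid (l i : nat) : R := (l == 0)%N%:R.

(** The expansion of (1 - 1) ^ l; the terms beyond l vanish. *)
Lemma binl_alternating (n l i : nat) : (l <= n)%N ->
  no_leaf_kid l i = \sum_(k < n.+1) (-1) ^+ k * binl R k l i.
Proof.
move=> ln; rewrite -(subnKC (ln : (l.+1 <= n.+1)%N)) big_split_ord /=.
rewrite [X in _ = _ + X]big1 ?addr0 => [|k _]; last first.
  by rewrite /binl bin_small ?mulr0 // ltnS leq_addr.
transitivity ((1 - 1 : R) ^+ l); first by rewrite subrr expr0n.
rewrite exprBn; apply: eq_bigr => k _.
by rewrite !expr1n !mulr1 /binl mulr_natr.
Qed.

Lemma root_no_leaf_kid (n : nat) : root_mean n no_leaf_kid = expsum (-1) n.+1.
Proof.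
rewrite /root_mean (eq_census _ (@binl_alternating n)) census_sum.
rewrite /expsum big_mkord.
apply: eq_bigr => k _; rewrite -/(root_mean _ _) root_binl.
by rewrite -ltnS ltn_ord mul1r.
Qed.

(** Each moment splits as (n - k) / (k + 1)! = (n + 1) / (k + 1)! - 1 / k!, and
    both parts sum to partial sums of exp(-1). *)
Lemma rest_no_leaf_kid (n : nat) :
  rest_mean n no_leaf_kid
  = n.+1%:R * (1 - expsum (-1) n.+2) - expsum (-1) n.+1.
Proof.
rewrite /rest_mean (eq_census _ (@binl_alternating n)) census_sum.
rewrite {1}/expsum big_nat_recl // expr0 divr1 opprD addNKr.
rewrite /expsum !big_mkord -sumrN big_distrr -sumrB /=.
apply: eq_bigr => k _; rewrite -/(rest_mean _ _) rest_binl.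
have kn : (k <= n)%N by rewrite -ltnS.
have := natr_fact_neq0 R k; have := natrS_neq0 R k.
rewrite natrB // exprS factS natrM -!natr1 => k1 fk; field.
by rewrite k1 fk.
Qed.

Lemma census_one (A : pred nat) (n : nat) :
  census A n (fun=> fun=> 1 : R) = census A n (binl R 0).
Proof. by apply: eq_census => l i _; rewrite /binl bin0. Qed.

Lemma census_has_leaf_kid (A : pred nat) (n : nat) :
  census A n (fun l _ => (0 < l)%N%:R : R)
  = census A n (binl R 0) - census A n no_leaf_kid.
Proof.
rewrite -[census A n (binl R 0)]mul1r -mulN1r -census_lin.
apply: eq_census => l i _; rewrite /binl bin0 mul1r /no_leaf_kid.
by case: l => [|l]; rewrite ?mulr1 ?subrr // mulr0 addr0.
Qed.

Lemma root_one (n : nat) : root_mean n (fun=> fun=> 1 : R) = 1.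
Proof.
by rewrite /root_mean census_one -/(root_mean _ _) root_binl fact0 divr1.
Qed.

Lemma rrt_expect_div (n : nat) (X : history n.+1 -> nat) :
  rrt_expect (fun f => (X f)%:R / n.+1%:R : R)
  = rrt_expect (fun f => (X f)%:R) / n.+1%:R.
Proof.
rewrite mulrC -rrt_expectZ; apply: eq_rrt_expect => f; exact: mulrC.
Qed.

(** The root is a leaf with probability 1 / n.+1, and half of the nodes are
    childless in the mean. *)
Lemma expect_leaves (n : nat) :
  rrt_expect (fun f : history n.+2 =>
     ((kids f 0 == 1) + \sum_(v < n.+1) (kids f v.+1 == 0))%N%:R)
  = n.+1%:R^-1 + n.+2%:R / 2 :> R.
Proof.
have -> : n.+1%:R^-1 = stem_mean n.+1 (fun=> fun=> 1 : R).
  by rewrite stem_meanE root_one mulr1.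
have -> : n.+2%:R / 2 = rest_mean n.+1 (star_at R 0).
  by rewrite rest_star_at mul1r.
rewrite rest_meanE -rrt_expectD; apply: eq_rrt_expect => f.
rewrite natrD natr_sum mulr1; congr (_ + _); apply: eq_bigr => v _.
by rewrite kidsE addn_eq0.
Qed.

Lemma mean_rank0 (n : nat) :
  r_ R 0 n.+2 = 1 / 2 + 1 / (n.+2%:R * (n.+2%:R - 1)).
Proof.
rewrite /r_ rrt_expect_div.
under eq_rrt_expect => f do rewrite nb_rank0E.
rewrite expect_leaves.
rewrite -[n.+2%:R]natr1 addrK -!natr1.
by field; rewrite !natr1 !natrS_neq0.
Qed.

Lemma mean_layer0 (n : nat) :
  l_ R 0 n.+2 = 1 / 2 + 1 / (n.+2%:R * (n.+2%:R - 1)).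
Proof.
rewrite -mean_rank0 /l_ /r_; apply: eq_rrt_expect => f.
by rewrite nb_rank0E nb_layer0E.
Qed.

(** The three terms come from the nodes other than the root, the root and the
    stem; the contributions of expsum (-1) n.+3 cancel between the first two. *)
Lemma mean_rank1_expsum (n : nat) :
  r_ R 1 n.+3
  = expsum (-1) n.+4 + expsum (-1) n.+2 / (n.+3%:R * n.+2%:R).
Proof.
rewrite /r_ rrt_expect_div.
have -> : rrt_expect (fun f : history n.+3 => (nb_rank 1 f)%:R)
  = root_mean n.+2 (fun l _ => (0 < l)%N%:R : R)
    + rest_mean n.+2 (fun l _ => (0 < l)%N%:R : R) + stem_mean n.+2 no_leaf_kid.
  rewrite rest_meanE root_meanE -!rrt_expectD; apply: eq_rrt_expect => f.
  rewrite nb_rank1E // !natrD natr_sum; congr (_ + _).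
  by rewrite -natrM mulnb.
rewrite stem_meanE /root_mean /rest_mean !census_has_leaf_kid.
rewrite -!/(root_mean _ _) -!/(rest_mean _ _).
rewrite !root_no_leaf_kid rest_no_leaf_kid.
rewrite root_binl rest_binl subn0 !divr1 /=.
rewrite -!natr1.
by field; rewrite !natr1 !natrS_neq0.
Qed.

(** The probability that exactly one child of the root has children, in a tree
    on n.+1 nodes (root_one_inner_kid). *)
Definition mean_one_inner_kid (n : nat) : R :=
  \sum_(j < n.+1) (j.+1 < n)%N%:R / (j`!%:R * (n%:R - j%:R)).

Lemma root_no_inner_kid (n : nat) :
  root_mean n (fun _ i => (i == 0)%N%:R) = 1 / n`!%:R :> R.
Proof.
rewrite /root_mean (@eq_census _ _ _ _
  (fun l i => \sum_(j < n.+1) 1 * star_at R j l i)) => [|l i ln].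
  rewrite (census_sum _ _ _ (fun=> 1) (star_at R)).
  rewrite big_ord_recr /= big1 => [|j _].
    by rewrite -/(root_mean _ _) root_star_at eqxx add0r mul1r.
  by rewrite -/(root_mean _ _) root_star_at ltn_eqF // mul0r mulr0.
rewrite (bigD1 (Ordinal (ln : (l < n.+1)%N))) //= big1 => [|j].
  by rewrite /star_at eqxx mul1r addr0.
by rewrite -val_eqE /star_at /= eq_sym => /negbTE ->; rewrite mulr0.
Qed.

Lemma root_one_inner_kid (n : nat) :
  root_mean n (fun _ i => (i == 1)%N%:R) = mean_one_inner_kid n :> R.
Proof.
rewrite /root_mean (@eq_census _ _ _ _
  (fun l i => \sum_(j < n.+1) 1 * near_star_at R j l i)) => [|l i ln].
  rewrite (census_sum _ _ _ (fun=> 1) (near_star_at R)); apply: eq_bigr => j _.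
  by rewrite -/(root_mean _ _) root_near_star_at mul1r.
rewrite (bigD1 (Ordinal (ln : (l < n.+1)%N))) //= big1 => [|j].
  by rewrite /near_star_at eqxx mul1r addr0.
by rewrite -val_eqE /near_star_at /= eq_sym => /negbTE ->; rewrite mulr0.
Qed.

Lemma rest_star (n : nat) :
  rest_mean n (fun l i => ((0 < l) && (i == 0))%N%:R)
  = n.+1%:R * \sum_(1 <= j < n) 1 / j.+2`!%:R :> R.
Proof.
rewrite /rest_mean (@eq_census _ _ _ _
  (fun l i => \sum_(j < n.+1) (0 < j)%N%:R * star_at R j l i)) => [|l i ln].
  rewrite (census_sum _ _ _ (fun j => (0 < j)%N%:R) (star_at R)).
  under eq_bigr => j _ do rewrite -/(rest_mean _ _) rest_star_at.
  rewrite big_ord_recl mul0r add0r.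
  rewrite big_distrr /=.
  case: n => [|n]; first by rewrite big_ord0 big_geq.
  rewrite big_add1 big_mkord big_ord_recr /= ltnn mul0r mulr0 addr0.
  by apply: eq_bigr => j _; rewrite /bump /= add1n ltnS ltn_ord !mul1r.
rewrite (bigD1 (Ordinal (ln : (l < n.+1)%N))) //= big1 => [|j].
  by rewrite /star_at eqxx addr0 -natrM mulnb.
by rewrite -val_eqE /star_at /= eq_sym => /negbTE ->; rewrite mulr0.
Qed.

(** The root contributes when it has at most one child with children, unless it
    is a leaf: this is the state i = 0 or i = 1 minus the event l + i = 1. *)
Lemma mean_layer1_counts (n : nat) :
  l_ R 1 n.+3
  = (1 / n.+2`!%:R + mean_one_inner_kid n.+2 - n.+2%:R^-1
     + n.+3%:R * \sum_(1 <= j < n.+2) 1 / j.+2`!%:R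
     + n.+2%:R^-1 * mean_one_inner_kid n.+1) / n.+3%:R.
Proof.
rewrite /l_ rrt_expect_div; congr (_ / _).
rewrite -(root_one_inner_kid n.+1) -stem_meanE -rest_star.
have -> : n.+2%:R^-1 = stem_mean n.+2 (fun=> fun=> 1 : R).
  by rewrite stem_meanE root_one mulr1.
rewrite -root_no_inner_kid -root_one_inner_kid -[- _]mulN1r -rrt_expectZ.
rewrite !root_meanE rest_meanE -!rrt_expectD.
apply: eq_rrt_expect => f; rewrite nb_layer1E // !natrD natr_sum.
rewrite -natrM mulnb; congr (_ + _ + _).
rewrite !kidsE; case: (leaf_kids f 0) (inner_kids f 0) => [|[|l]] [|[|i]] //=;
  rewrite ?addnS ?addn0 /=; ring.
Qed.

Lemma mean_one_inner_kidE (n : nat) :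
  mean_one_inner_kid n = \sum_(0 <= j < n.-1) 1 / (j`!%:R * (n%:R - j%:R)).
Proof.
case: n => [|n]; first by rewrite /mean_one_inner_kid big_ord1 mul0r big_geq.
rewrite /mean_one_inner_kid big_ord_recr big_ord_recr /= ltnn ltnNge leqnSn.
rewrite !mul0r !addr0.
by rewrite big_mkord; apply: eq_bigr => j _; rewrite ltnS ltn_ord.
Qed.

(** Writing n + 1 = (n + 1 - j) + j turns the term of index j into 1 / j! plus
    the term of index j - 1 for n. *)
Lemma mean_one_inner_kidS (n : nat) :
  n.+1%:R * mean_one_inner_kid n.+1 = mean_one_inner_kid n + expsum 1 n.
Proof.
rewrite !mean_one_inner_kidE /= /expsum.
case: n => [|n]; first by rewrite !big_geq // mulr0 addr0.
rewrite addrC [in RHS]big_nat_recl //= -addrA addrC.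
rewrite big_nat_recl // mulrDr [in RHS]addrC big_distrr /=.
rewrite -big_split /=; congr (_ + _).
  by rewrite subr0 fact0 expr0 !mul1r invr1 mulfV // natrS_neq0.
rewrite big_nat_cond [RHS]big_nat_cond.
apply: eq_bigr => j /andP[/andP[_ jn] _].
have fj := natr_fact_neq0 R j; have j1 := natrS_neq0 R j.
have u : n.+1%:R - j%:R != 0 :> R by rewrite subr_eq0 eqr_nat gtn_eqF // ltnW.
have -> : n.+2%:R - j.+1%:R = n.+1%:R - j%:R :> R by rewrite -!natr1; ring.
rewrite expr1n factS natrM -[n.+2%:R]natr1 -[j.+1%:R]natr1 in j1 *.
move: (n.+1%:R : R) u => x u.
by field; rewrite fj u j1.
Qed.

End Exact.

(** * Closed forms *)

Section ClosedForms.
Variable R : realType.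

Lemma sum_inv_fact_shift (m : nat) :
  \sum_(1 <= j < m.+1) 1 / j.+2`!%:R = expsum 1 m.+3 - 5 / 2 :> R.
Proof.
elim: m => [|m IHm].
  rewrite big_geq // /expsum !big_nat_recr //= big_geq //.
  rewrite !factS fact0 !expr1n !divr1 add0r; lra.
by rewrite big_nat_recr //= IHm [in RHS]expsumS expr1n addrAC.
Qed.

(** The form used for the expansion: the partial sums carry the limits, and
    mean_one_inner_kid is a vanishing correction. *)
Lemma mean_layer1_expsum (m : nat) :
  l_ R 1 m.+3
  = expsum 1 m.+4 - 5 / 2 + 1 / m.+3`!%:R
    + (expsum 1 m.+1 - 1 + 2 * mean_one_inner_kid R m.+1) / (m.+3%:R * m.+2%:R).
Proof.
rewrite mean_layer1_counts sum_inv_fact_shift.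
have := @mean_one_inner_kidS R m.+1 => E.
have -> : mean_one_inner_kid R m.+2
        = (mean_one_inner_kid R m.+1 + expsum 1 m.+1) / m.+2%:R.
  by rewrite -E mulrC mulKf // natrS_neq0.
rewrite [m.+3`!]factS natrM; have f := natr_fact_neq0 R m.+2.
rewrite -!natr1; field; by rewrite f !natr1 !natrS_neq0.
Qed.

(** The factor j shifts the series by one term and changes its sign, so the
    weighted sum telescopes up to its last term. *)
Lemma sum_alternating_weighted (m : nat) :
  \sum_(0 <= j < m.+1) (-1) ^+ j / j`!%:R * (j%:R + 2)
  = expsum (-1) m.+1 + (-1) ^+ m / m`!%:R :> R.
Proof.
elim: m => [|m IHm].
  by rewrite /expsum !big_nat1 expr0 fact0 divr1; ring.
rewrite big_nat_recr //= IHm [in RHS]expsumS.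
rewrite exprS factS natrM; move: (natr_fact_neq0 R m) (natrS_neq0 R m).
move: (m`!%:R : R) => F f m1; rewrite -natr1 in m1 *.
by field; rewrite f m1.
Qed.

Lemma mean_rank1 (m : nat) :
  r_ R 1 m.+3
  = expsum (-1) m.+2
    + 1 / (m.+3%:R * (m.+3%:R - 1))
      * \sum_(0 <= j < m.+1) (-1) ^+ j / j`!%:R * (j%:R + 2).
Proof.
rewrite mean_rank1_expsum sum_alternating_weighted 3!expsumS.
rewrite [m.+3`!]factS natrM [m.+2`!]factS natrM [m.+1`!]factS natrM !exprS.
move: (m`!%:R : R) (natr_fact_neq0 R m) => F f.
have -> : m.+3%:R - 1 = m.+2%:R :> R by rewrite -natr1 addrK.
rewrite -!natr1; field.
by rewrite f !natr1 !natrS_neq0.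
Qed.

(** The double sum is mean_one_inner_kidS unrolled. *)
Lemma fact_mean_one_inner_kid (n : nat) :
  n`!%:R * mean_one_inner_kid R n
  = \sum_(1 <= j < n) \sum_(0 <= v < j) j`!%:R / v`!%:R.
Proof.
elim: n => [|[|n] IHn].
- by rewrite mean_one_inner_kidE !big_geq // mulr0.
- by rewrite mean_one_inner_kidE !big_geq // mulr0.
rewrite factS natrM mulrAC mean_one_inner_kidS mulrDl mulrC IHn.
rewrite [in RHS]big_nat_recr //= mulrC big_distrr /=; congr (_ + _).
by apply: eq_bigr => v _; rewrite expr1n mul1r.
Qed.

Lemma mean_layer1 (m : nat) :
  l_ R 1 m.+3 =
          - (1 / 2) + 1 / m.+3%:R - 1 / (m.+3%:R - 1) + 2 / m.+3`!%:R
          + \sum_(2 <= v < m.+3) 1 / v`!%:R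
          - 1 / (m.+3%:R * (m.+3%:R - 1)) * \sum_(0 <= v < m.+1) 1 / v`!%:R
          + 2 / m.+3`!%:R
            * \sum_(1 <= j < m.+2) \sum_(0 <= v < j) j`!%:R / v`!%:R.
Proof.
rewrite -fact_mean_one_inner_kid mean_layer1_expsum.
have -> : \sum_(0 <= v < m.+1) 1 / v`!%:R = expsum 1 m.+1 :> R.
  by apply: eq_bigr => v _; rewrite expr1n.
have -> : \sum_(2 <= v < m.+3) 1 / v`!%:R = expsum 1 m.+3 - 2 :> R.
  rewrite /expsum 2?[in RHS]big_ltn // !expr1n divr1.
  under [in RHS]eq_bigr => v _ do rewrite expr1n.
  by ring.
have -> : mean_one_inner_kid R m.+1
        = m.+2%:R * mean_one_inner_kid R m.+2 - expsum 1 m.+1.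
  by rewrite mean_one_inner_kidS addrK.
have -> : m.+3%:R - 1 = m.+2%:R :> R by rewrite -natr1 addrK.
rewrite expsumS expr1n [m.+3`!]factS natrM.
move: (m.+2`!%:R : R) (natr_fact_neq0 R m.+2) => F f.
rewrite -!natr1; field.
by rewrite f !natr1 !natrS_neq0.
Qed.

End ClosedForms.

(** * Asymptotic expansions *)

Section Asymptotics.
Variable R : realType.

Lemma natr_fact_gt0 (n : nat) : 0 < n`!%:R :> R.
Proof. by rewrite ltr0n fact_gt0. Qed.

(** Dominating the terms of the exponential series by a telescoping series
    avoids geometric sums in the tail bound. *)
Lemma invf_fact_telescope (n : nat) : (0 < n)%N ->
  n`!%:R^-1 <= 2 / n`!%:R - 2 / n.+1`!%:R :> R.
Proof.
move=> n0; rewrite factS natrM invfM.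
have x0 : 0 <= n`!%:R^-1 :> R by rewrite invr_ge0 ler0n.
have y0 : 0 <= 1 - 2 * n.+1%:R^-1 :> R.
  by rewrite subr_ge0 ler_pdivrMr ?ltr0n // mul1r ler_nat.
have := mulr_ge0 x0 y0.
move: (n`!%:R^-1) (n.+1%:R^-1) => x y; lra.
Qed.

Lemma expsum_cauchy (x : R) (n d : nat) : `|x| <= 1 -> (0 < n)%N ->
  `|expsum x (n + d) - expsum x n| <= 2 / n`!%:R - 2 / (n + d)`!%:R.
Proof.
move=> x1 n0; elim: d => [|d IHd]; first by rewrite addn0 !subrr normr0.
rewrite addnS expsumS addrAC; apply: le_trans (ler_normD _ _) _.
have t := @invf_fact_telescope (n + d) (ltn_addr d n0).
have : `|x ^+ (n + d) / (n + d)`!%:R| <= (n + d)`!%:R^-1.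
  rewrite normrM normrX normfV [`|_%:R|]ger0_norm ?ler0n //.
  by rewrite ler_piMl ?invr_ge0 ?ler0n // exprn_ile1.
move: IHd t; rewrite -addnS; lra.
Qed.

Lemma expR_tail (x : R) (n : nat) : `|x| <= 1 -> (0 < n)%N ->
  `|expsum x n - expR x| <= 2 / n`!%:R.
Proof.
move=> x1 n0; apply/ler_addgt0Pr => e e0.
have /cvgrPdist_le /(_ e e0) [N _ HN] := is_cvg_series_exp_coeff x.
have : `|expR x - expsum x (n + N)| <= e.
  by apply: HN => /=; rewrite leq_addl.
have := @expsum_cauchy x n N x1 n0; have := natr_fact_gt0 (n + N).
rewrite -invr_gt0 => f0 h1 h2.
have := ler_normD (expsum x n - expsum x (n + N)) (expsum x (n + N) - expR x).
rewrite addrA subrK [`|expsum x n - expsum x (n + N)|]distrC.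
rewrite [`|expsum x (n + N) - expR x|]distrC; lra.
Qed.

Lemma expsum1_le3 (n : nat) : expsum 1 n <= 3 :> R.
Proof.
case: n => [|n]; first by rewrite /expsum big_geq // ler0n.
have := @expsum_cauchy 1 1 n; rewrite normr1 => /(_ (lexx _) isT).
have -> : expsum 1 1 = 1 :> R by rewrite /expsum big_nat1 expr0 divr1.
have := natr_fact_gt0 (1 + n); rewrite -invr_gt0 add1n.
have := ler_norm (expsum 1 n.+1 - 1 : R); rewrite divr1; lra.
Qed.

Lemma mean_one_inner_kid_ge0 (n : nat) : 0 <= mean_one_inner_kid R n.
Proof.
apply: sumr_ge0 => j _; rewrite divr_ge0 ?ler0n // mulr_ge0 ?ler0n //.
by rewrite subr_ge0 ler_nat -ltnS.
Qed.

(** The recurrence divides a bounded quantity by n.+1. *)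
Lemma mean_one_inner_kid_le (n : nat) :
  n.+1%:R * mean_one_inner_kid R n.+1 <= 6.
Proof.
have q3 (k : nat) : mean_one_inner_kid R k <= 3.
  (* The values at 0 and 1 vanish; from 2 on, (3 + 3) / k <= 3. *)
  elim: k => [|[|k] IHk].
  - by rewrite mean_one_inner_kidE big_geq.
  - by rewrite mean_one_inner_kidE big_geq.
  rewrite -(ler_pM2l (ltr0Sn R k.+1)) mean_one_inner_kidS.
  have := expsum1_le3 k.+1.
  have : 2 <= k.+2%:R :> R by rewrite ler_nat.
  lra.
rewrite mean_one_inner_kidS; have := q3 n; have := expsum1_le3 n; lra.
Qed.

Local Open Scope classical_set_scope.

(** The closed forms hold from n = 3 on, whence the shift. *)
Lemma bigO_of_bound (f g h : nat -> R) (K : R) :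
  (forall m, `|f m.+3 - g m.+3| <= K * `|h m.+3|) ->
  (f : nat -> R^o) = (g : nat -> R^o) +O_\oo (h : nat -> R^o).
Proof.
move=> fgh; apply/eqaddOP; near=> k; exists 3%N => // n /= n3.
have nE : n = (n - 3).+3 by rewrite -[LHS](subnKC n3).
by rewrite nE; apply: le_trans (fgh _) _; rewrite ler_wpM2r.
Unshelve. all: by end_near. Qed.

(** Both partial sums are replaced by their limit. The tail of the second one
    starts two terms earlier, and its factor 1 / (n (n - 1)) brings it down to
    the same order. *)
Lemma mean_rank1_bigO :
  ((fun n : nat => r_ R 1 n : R^o) =
        (fun n : nat => expR (-1) + expR (-1) / (n%:R * (n%:R - 1)))
        +O_\oo (fun n : nat => 1 / (n.+1)`!%:R : R^o)).
Proof.
(* 6 = 2 + 2 * 2: two tail bounds, the second with (n + 1) / (n - 1) <= 2. *)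
apply: (@bigO_of_bound _ _ _ 6) => m; rewrite mean_rank1_expsum.
have -> : m.+3%:R - 1 = m.+2%:R :> R by rewrite -natr1 addrK.
have N1 : `|-1 : R| <= 1 by rewrite normrN1.
have := @expR_tail (-1) m.+4 N1 isT; have := @expR_tail (-1) m.+2 N1 isT.
set a := expsum _ m.+2; set b := expsum _ m.+4; set e := expR _ => ha hb.
rewrite [`|1 / _|]ger0_norm ?divr_ge0 ?ler0n //.
have -> : b + a / (m.+3%:R * m.+2%:R) - (e + e / (m.+3%:R * m.+2%:R))
        = (b - e) + (a - e) / (m.+3%:R * m.+2%:R) by ring.
apply: le_trans (ler_normD _ _) _.
rewrite normrM [`|_^-1|]ger0_norm ?invr_ge0 ?mulr_ge0 ?ler0n //.
have : `|a - e| / (m.+3%:R * m.+2%:R) <= 2 / m.+2`!%:R / (m.+3%:R * m.+2%:R).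
  by rewrite ler_wpM2r // invr_ge0 mulr_ge0 ?ler0n.
have -> : 2 / m.+2`!%:R / (m.+3%:R * m.+2%:R)
        = 2 / m.+4`!%:R * (m.+4%:R / m.+2%:R) :> R.
  rewrite [m.+4`!]factS [m.+3`!]factS natrM natrM.
  move: (m.+2`!%:R : R) (natr_fact_neq0 R m.+2) => F f.
  by rewrite -!natr1; field; rewrite f !natr1 !natrS_neq0.
have : m.+4%:R / m.+2%:R <= 2 :> R.
  by rewrite ler_pdivrMr ?ltr0n // -natrM ler_nat; lia.
have f0 : 0 <= 2 / m.+4`!%:R :> R by rewrite divr_ge0 ?ler0n.
move=> /(ler_wpM2l f0); move: hb; rewrite div1r.
move: (m.+4`!%:R^-1) (m.+4%:R / m.+2%:R) (`|a - e| / _) => F c d; lra.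
Qed.

(** With w = 1 / (n (n - 1)) and u = 1 / (n (n - 1) (n - 2)), the error is the
    sum of two tails of exp(1), of 1 / n!, of a multiple of mean_one_inner_kid
    and of w - 1 / n ^ 2, each of which is at most a multiple of u. *)
Lemma mean_layer1_bigO :
  ((fun n : nat => l_ R 1 n : R^o) =
        (fun n : nat => expR 1 - 5 / 2 + (expR 1 - 1) / n%:R ^+ 2)
        +O_\oo (fun n : nat => 1 / n%:R ^+ 3 : R^o)).
Proof.
(* The errors add up to 19 u, and 19 u <= 100 / n ^ 3 for n >= 3. *)
apply: (@bigO_of_bound _ _ _ 100) => m; rewrite mean_layer1_expsum.
have N1 : `|1 : R| <= 1 by rewrite normr1.
have := @expR_tail 1 m.+4 N1 isT; have := @expR_tail 1 m.+1 N1 isT.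
have := @expR_tail 1 1 N1 isT.
have -> : expsum 1 1 = 1 :> R by rewrite /expsum big_nat1 expr0 divr1.
have := mean_one_inner_kid_le m; have := mean_one_inner_kid_ge0 m.+1.
set a := expsum _ m.+1; set b := expsum _ m.+4; set e := expR _.
set q := mean_one_inner_kid _ _ => q0 q6 he ha hb.
(* x stands for n - 2, where n = m.+3. *)
pose x : R := m.+1%:R; have x1 : 1 <= x by rewrite ler1n.
have x0 : 0 < x by apply: lt_le_trans x1.
have n1E : m.+2%:R = x + 1 by rewrite natr1.
have nE : m.+3%:R = x + 1 + 1 by rewrite !natr1.
pose u : R := (x * (x + 1) * (x + 1 + 1))^-1.
have xa : 0 < x + 1 by rewrite addr_gt0.
have xb : 0 < x + 1 + 1 by rewrite addr_gt0.
have xP : 0 < x * (x + 1) * (x + 1 + 1) by rewrite !mulr_gt0.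
have u0 : 0 <= u by rewrite invr_ge0 ltW.
have f1 : m.+1`!%:R^-1 <= x^-1.
  by rewrite lef_pV2 ?posrE ?natr_fact_gt0 // ler_nat factS leq_pmulr ?fact_gt0.
have f3 : m.+3`!%:R^-1 <= u.
  rewrite lef_pV2 ?posrE ?natr_fact_gt0 // !factS !natrM nE n1E -/x.
  have -> : (x + 1 + 1) * ((x + 1) * (x * m`!%:R))
          = x * (x + 1) * (x + 1 + 1) * m`!%:R :> R by ring.
  by rewrite ler_peMr ?ler1n ?fact_gt0 // ltW.
have f4 : m.+4`!%:R^-1 <= u.
  apply: le_trans f3; rewrite lef_pV2 ?posrE ?natr_fact_gt0 // ler_nat.
  by rewrite [m.+4`!]factS leq_pmull.
have q_le : q <= 6 / x by rewrite ler_pdivlMr // mulrC.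
pose w : R := (m.+3%:R * m.+2%:R)^-1.
have wE : w = x * u by rewrite /w /u nE n1E; field; rewrite !gt_eqF.
have w0 : 0 <= w by rewrite wE mulr_ge0 // ltW.
have -> : b - 5 / 2 + 1 / m.+3`!%:R + (a - 1 + 2 * q) / (m.+3%:R * m.+2%:R)
            - (e - 5 / 2 + (e - 1) / m.+3%:R ^+ 2)
        = (b - e) + m.+3`!%:R^-1 + (a - e) * w + 2 * q * w
          + (e - 1) * (w - (m.+3%:R ^+ 2)^-1).
  by rewrite -/w; ring.
have h3 : `|(a - e) * w| <= 2 * u.
  rewrite normrM [`|w|]ger0_norm // wE mulrA ler_wpM2r // -ler_pdivlMr //.
  by apply: le_trans ha _; rewrite ler_pM2l.
have h4 : `|2 * q * w| <= 12 * u.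
  rewrite ger0_norm ?mulr_ge0 // wE mulrA ler_wpM2r // -ler_pdivlMr //.
  by rewrite (_ : 12 / x = 2 * (6 / x)); [rewrite ler_pM2l | ring].
have h5 : `|(e - 1) * (w - (m.+3%:R ^+ 2)^-1)| <= 2 * u.
  have -> : w - (m.+3%:R ^+ 2)^-1 = u * (x / (x + 1 + 1)).
    rewrite /w /u nE n1E; field.
    by rewrite !gt_eqF.
  rewrite mulrCA normrM [`|u|]ger0_norm // mulrC ler_wpM2r // normrM.
  have -> : 2 = 2 * 1 :> R by rewrite mulr1.
  apply: ler_pM => //; first by move: he; rewrite distrC divr1.
  rewrite ger0_norm; last by rewrite divr_ge0 // ltW.
  by rewrite ler_pdivrMr // mul1r -addrA lerDl.
have h1 : `|b - e| <= 2 * u by apply: le_trans hb _; rewrite ler_pM2l.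
have h2 : `|m.+3`!%:R^-1| <= u by rewrite ger0_norm // invr_ge0 ler0n.
have h6 : 19 * u <= 100 * `|1 / m.+3%:R ^+ 3|.
  rewrite ger0_norm ?divr_ge0 ?exprn_ge0 ?ler0n // nE div1r.
  rewrite /u ler_pdivrMr // mulrAC ler_pdivlMr ?exprn_gt0 //.
  have xx := mulr_ge0 (ltW x0) (ltW x0).
  rewrite -subr_ge0.
  have -> : 100 * (x * (x + 1) * (x + 1 + 1)) - 19 * (x + 1 + 1) ^+ 3
     = (x + 1 + 1) * (81 * (x * x) + 24 * x - 76) by ring.
  by rewrite mulr_ge0 ?ltW //; nra.
apply: le_trans h6.
have -> : 19 * u = 2 * u + u + 2 * u + 12 * u + 2 * u by ring.
by do 4! (apply: le_trans (ler_normD _ _) _; apply: lerD => //).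
Qed.


End Asymptotics.

Unset Implicit Arguments.
Local Open Scope classical_set_scope.
Local Open Scope ring_scope.

Theorem theorem7 (R : realType) :
  (forall n : nat, (2 < n)%N ->
    [/\ r_ R 0 n = 1 / 2 + 1 / (n%:R * (n%:R - 1)),
        l_ R 0 n = 1 / 2 + 1 / (n%:R * (n%:R - 1)),
        r_ R 1 n =
          \sum_(0 <= j < (n - 2).+1) (-1) ^+ j / j`!%:R
          + 1 / (n%:R * (n%:R - 1))
            * \sum_(0 <= j < (n - 3).+1) (-1) ^+ j / j`!%:R * (j%:R + 2)
      & l_ R 1 n =
          - (1 / 2) + 1 / n%:R - 1 / (n%:R - 1) + 2 / n`!%:R
          + \sum_(2 <= v < n) 1 / v`!%:R
          - 1 / (n%:R * (n%:R - 1)) * \sum_(0 <= v < (n - 3).+1) 1 / v`!%:R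
          + 2 / n`!%:R
            * \sum_(1 <= j < (n - 2).+1) \sum_(0 <= v < j) j`!%:R / v`!%:R])
  /\ ((fun n : nat => r_ R 1 n : R^o) =
        (fun n : nat => expR (-1) + expR (-1) / (n%:R * (n%:R - 1)))
        +O_\oo (fun n : nat => 1 / (n.+1)`!%:R : R^o))
  /\ ((fun n : nat => l_ R 1 n : R^o) =
        (fun n : nat => expR 1 - 5 / 2 + (expR 1 - 1) / n%:R ^+ 2)
        +O_\oo (fun n : nat => 1 / n%:R ^+ 3 : R^o)).
Proof.
split; last by split; [exact: mean_rank1_bigO | exact: mean_layer1_bigO].
case=> [|[|[|m]]] // _; rewrite !subSS !subn0; split.
- exact: mean_rank0.
- exact: mean_layer0.
- exact: mean_rank1.
- exact: mean_layer1.
Qed.
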